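(* Let $G$ be a connected unicyclic graph on $n\geq 10$ vertices such that $p(G)=q(G)$ and $G$ contains no pendant path $P_3$. Then $$m_{L(G)}(1)\leq \frac{n}{4},$$ and equality holds if and only if $n=4k$ for some integer $k$ and $G$ is isomorphic to the graph obtained from a cycle $c_1a_1b_1c_2a_2b_2\cdots c_ka_kb_kc_1$ of length $3k$ by attaching exactly one pendant vertex to each of $c_1,\dots,c_k$ (so every cycle vertex has degree $2$ or $3$, and consecutive degree-$3$ cycle vertices are separated by exactly two degree-$2$ cycle vertices).
   Context: All graphs are finite, simple and undirected; a unicyclic graph is a connected graph with exactly one cycle. $L(G)=D(G)-A(G)$ is the Laplacian matrix, and $m_{L(G)}(1)$ is the multiplicity of $1$ as an eigenvalue of $L(G)$. A pendant vertex has degree $1$; a quasi-pendant vertex is adjacent to a pendant vertex; $p(G)$, $q(G)$ are the numbers of pendant and quasi-pendant vertices. A pendant path $P_k$ of $G$ means that $G$ is obtained from a graph $G_1$ and a path $P_k$ by joining one end vertex of $P_k$ to a vertex of $G_1$ by an edge. *)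

(* Defs.v *)
From HB Require Import structures.
From mathcomp Require Import all_boot all_order all_algebra.

Set Implicit Arguments.
Unset Strict Implicit.
Unset Printing Implicit Defensive.

Import Order.TTheory GRing.Theory Num.Theory.

Local Open Scope ring_scope.

Definition simple_graph (T : finType) (e : rel T) : Prop :=
  symmetric e /\ irreflexive e.

Definition graph_iso (T1 T2 : finType) (e1 : rel T1) (e2 : rel T2) : Prop :=
  exists2 f : T1 -> T2, bijective f & {mono f : x y / e1 x y >-> e2 x y}.

Section Graph.

Variables (T : finType) (e : rel T).

Definition connected_graph : Prop := forall x y : T, connect e x y.

(* A cycle, being a subgraph, is identified with its edge set; the sequences  *)
(* tracing a given cycle (one per starting point and direction) all yield the *)
(* same edge set.                                                             *)
Definition cycle_edges (c : seq T) : {set {set T}} :=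
  [set [set x; next c x] | x in c].

Definition graph_cycle (C : {set {set T}}) : Prop :=
  exists c : seq T, [/\ ucycle e c, (2 < size c)%N & C = cycle_edges c].

Definition unicyclic : Prop :=
  connected_graph /\ exists! C : {set {set T}}, graph_cycle C.

Definition degree (x : T) : nat := #|[set y | e x y]|.

Definition pendant (x : T) : bool := degree x == 1%N.

Definition quasi_pendant (x : T) : bool := [exists y, e x y && pendant y].

Definition num_pendant : nat := #|[set x | pendant x]|.

Definition num_quasi_pendant : nat := #|[set x | quasi_pendant x]|.

(* The vertices v 0, ..., v (k - 1) induce the path P_k, the remaining        *)
(* vertices induce G_1, and the only edge between the two parts joins v 0 to  *)
(* the vertex u of G_1.                                                       *)
Definition has_pendant_path (k : nat) : Prop :=
  exists (v : 'I_k -> T) (u : T),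
    [/\ injective v,
        forall i, v i != u,
        forall i j, e (v i) (v j) = (i.+1 == j :> nat) || (j.+1 == i :> nat)
      & forall i y, (forall j, v j != y) ->
          e (v i) y = (i == 0%N :> nat) && (y == u)].

Variable R : nzRingType.

Definition degree_mx : 'M[R]_#|T| :=
  diag_mx (\row_i (degree (enum_val i))%:R).

Definition adjacency_mx : 'M[R]_#|T| :=
  \matrix_(i, j) (e (enum_val i) (enum_val j))%:R.

Definition laplacian_mx : 'M[R]_#|T| := degree_mx - adjacency_mx.

End Graph.

Definition eigen_mult (F : fieldType) (n : nat) (A : 'M[F]_n) (a : F) : nat :=
  mup a (char_poly A).

(* inl i is the i-th vertex of a cycle of length 3k, labelled cyclically as   *)
(* c_1 a_1 b_1 ... c_k a_k b_k, so that inl (3j) is c_(j+1); inr j is the     *)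
(* pendant vertex attached to c_(j+1).                                        *)
Definition extremal_rel (k : nat) : rel ('I_(3 * k) + 'I_k)%type :=
  fun x y =>
    match x, y with
    | inl i, inl j => (j == ordS i) || (i == ordS j)
    | inl i, inr j => i == (3 * j)%N :> nat
    | inr j, inl i => i == (3 * j)%N :> nat
    | inr _, inr _ => false
    end.

Arguments extremal_rel k _ _ : clear implicits.

(* Main.v *)
(* Let f send a cycle vertex to the next one along the cycle and any other    *)
(* vertex to a neighbour nearer to the cycle. As the cycle is unique, the     *)
(* edges are exactly the pairs {v, f v}, so deg v = 1 + (number of children   *)
(* of v), and Lx = x reads                                                    *)
(*   nchild v * x v = x (f v) + sum of x over the children of v.              *)
(* L is symmetric, so the multiplicity m of 1 is the dimension of the space   *)
(* of solutions, and m <= #|Z| as soon as the only solution vanishing on Z    *)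
(* is 0. Solutions vanish on the set Q of quasi-pendant vertices, and, since  *)
(* p = q, are determined by their values on the set V of vertices which are   *)
(* neither pendant nor quasi-pendant; n = 2q + #|V|.                          *)
(*   If the cycle meets Q, then V induces a forest. Working upwards, a        *)
(* solution is determined by its values on the vertices of V with a child in  *)
(* Q, whence m <= q; and it is determined by its values on either class of a  *)
(* 2-colouring of V, whence 2m <= #|V|. In case of equality any values on a   *)
(* colour class extend to a solution; extending indicator functions shows     *)
(* that V induces a perfect matching of vertices of degree 2, and the absence *)
(* of a pendant P_3 forces all vertices of Q to have degree 3.                *)
(*   If the cycle, of length g, lies in V, the same two arguments determine   *)
(* a solution off the cycle, while on the cycle it satisfies a recurrence     *)
(* a_i y_i = y_(i-1) + y_(i+1) with all a_i >= 1. Two values always determine *)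
(* y, and one does if g <= 5, or if g = 6 and the next a_i is > 1. In all     *)
(* cases this gives 4m < n.                                                   *)
Require Import Defs.
From mathcomp Require Import all_boot all_order all_algebra.
From mathcomp Require Import zify ring lra.

Set Implicit Arguments.
Unset Strict Implicit.
Unset Printing Implicit Defensive.

Import Order.TTheory GRing.Theory Num.Theory.

Local Open Scope ring_scope.

(** [mup_char_poly_sym] turns the multiplicity into a kernel dimension, [mult_le_forcing] bounds it,
    and [forcing_onto] exploits a tight bound. If the cycle meets [Q], the bound [m <= q]
    ([mult_le_fQ]) and the two class bounds ([forcing_colour]) add up to [4m <= n]; when all are
    tight, [V_matched], [nchildQ] and [cycle_notP] rebuild the graph. If the cycle lies in [V], it
    requires fewer extra values than its own length pays for ([mult_lt_attached]), or it is the
    whole graph and [n >= 10] suffices ([mult_lt_cycleV]). Conversely, the [k] independent solutions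
    [block_vec] attain the bound on the extremal graph. *)

(** * Algebraic versus geometric multiplicity for symmetric matrices *)

Lemma char_poly_similar (F : fieldType) (n : nat) (V A B : 'M[F]_n) :
  V \in unitmx -> V *m A = B *m V -> char_poly A = char_poly B.
Proof.
move=> Vu VA; rewrite /char_poly.
have detV : \det (map_mx polyC V) != 0.
  by rewrite det_map_mx polyC_eq0 -unitfE -unitmxE.
apply: (mulfI detV); rewrite -det_mulmx mulrC -det_mulmx; congr (\det _).
rewrite /char_poly_mx mulmxBr mulmxBl -!map_mxM VA; congr (_ - _).
by rewrite scalar_mxC.
Qed.

Lemma char_poly_block_diag (F : fieldType) (r s : nat)
    (A : 'M[F]_r) (D : 'M[F]_s) :
  char_poly (block_mx A 0 0 D) = char_poly A * char_poly D.
Proof.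
rewrite /char_poly /char_poly_mx map_block_mx scalar_mx_block.
by rewrite opp_block_mx add_block_mx !raddf0 !addr0 det_ublock.
Qed.

(** In the basis given by the rows of [K] and [M], [A] is block diagonal with blocks [a%:M] and [D];
    only the first contributes to the root [a], with multiplicity [r]. *)
Lemma mup_char_poly_split (F : fieldType) (n r s : nat) (A : 'M[F]_n) (a : F)
    (K : 'M[F]_(r, n)) (M : 'M[F]_(s, n)) (D : 'M[F]_s) :
  (r + s = n)%N -> row_free (col_mx K M) -> K *m A = a *: K ->
  M *m A = D *m M -> ~~ eigenvalue D a -> mup a (char_poly A) = r.
Proof.
move=> E; case: n / E A K M => A K M free_KM KA MA evD.
have Vu : col_mx K M \in unitmx by rewrite -row_free_unit.
have VA : col_mx K M *m A = block_mx a%:M 0 0 D *m col_mx K M.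
  by rewrite mul_col_mx KA MA mul_block_col !mul0mx addr0 add0r mul_scalar_mx.
rewrite (char_poly_similar Vu VA) char_poly_block_diag mupMl; last first.
  by rewrite -eigenvalue_root_char.
rewrite char_poly_trig ?scalar_mx_is_trig //.
under eq_bigr => i _ do rewrite mxE eqxx mulr1n.
by rewrite prodr_const card_ord mup_XsubCX eqxx.
Qed.

(* For symmetric [A], a vector of the row space of [A - a] killed by [A - a]  *)
(* is orthogonal to itself, so the space splits as kernel plus image.         *)
Lemma mup_char_poly_sym (F : realFieldType) (n : nat) (A : 'M[F]_n) (a : F) :
  A^T = A -> mup a (char_poly A) = \rank (kermx (A - a%:M)).
Proof.
move=> symA; pose B := A - a%:M.
have symB : B^T = B by rewrite /B linearB /= symA tr_scalar_mx.
have ker_im (w : 'rV[F]_n) : (w <= B)%MS -> w *m B = 0 -> w = 0.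
  case/submxP=> y -> yBB; apply/eqP; set z := y *m B.
  have zz : z *m z^T = 0.
    by rewrite {2}/z trmx_mul symB mulmxA yBB mul0mx.
  have {zz}/eqP : (z *m z^T) 0 0 = 0 by rewrite zz mxE.
  rewrite mxE psumr_eq0 => [/allP zz|i _]; last by rewrite [z^T _ _]mxE -expr2 sqr_ge0.
  apply/eqP/rowP=> i; have := zz i; rewrite mem_index_enum [z^T _ _]mxE [RHS]mxE.
  by move/(_ isT); rewrite -expr2 sqrf_eq0 => /eqP.
set K := row_base (kermx B); set M := row_base B.
have KB0 : K *m B = 0 by apply/sub_kermxP; rewrite eq_row_base.
have cap0 : (kermx B :&: B)%MS = 0.
  apply/eqP/rowV0P => w; rewrite sub_capmx => /andP[/sub_kermxP wB ?].
  exact: ker_im.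
have dimE : (\rank (kermx B) + \rank B = n)%N.
  by rewrite mxrank_ker subnK // rank_leq_row.
have free_KM : row_free (col_mx K M).
  rewrite /row_free -addsmxE mxrank_disjoint_sum ?eq_row_base //.
  by apply/eqP; rewrite -submx0 -cap0 capmxS // eq_row_base.
have MB : (M *m A <= M)%MS.
  rewrite eq_row_base -[A](subrK a%:M) -/B mulmxDr addmx_sub ?submxMl //.
  by rewrite mul_mx_scalar scalemx_sub // eq_row_base.
have /submxP[D MA] := MB.
apply: (mup_char_poly_split dimE free_KM _ MA).
  by apply/eqP; rewrite -subr_eq0 -mul_mx_scalar -mulmxBr KB0.
apply/negP => /eigenvalueP[v vD v0].
have vMB : v *m M *m B = 0.
  by rewrite /B mulmxBr -mulmxA MA mulmxA vD mul_mx_scalar scalemxAl subrr.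
have vM0 : v *m M = 0.
  by apply: ker_im => //; apply: submx_trans (submxMl _ _) _; rewrite eq_row_base.
case/eqP: v0; apply: (row_free_inj (row_base_free B)); rewrite /= -/M.
by rewrite vM0 mul0mx.
Qed.

(** * The eigenspace of 1 and forcing sets *)

Section LaplacianKernel.

Variables (R : realFieldType) (T : finType) (e : rel T).
Hypothesis sym_e : symmetric e.

Definition lap_fix (x : T -> R) : Prop :=
  forall v, ((degree e v)%:R - 1) * x v = \sum_(u | e v u) x u.

Let A : 'M[R]_#|T| := laplacian_mx e R - 1%:M.
Let vec (x : T -> R) : 'rV[R]_#|T| := \row_i x (enum_val i).
Let func (w : 'rV[R]_#|T|) : T -> R := fun v => w 0 (enum_rank v).

Let vecK w : vec (func w) = w.
Proof. by apply/rowP=> i; rewrite !mxE /func enum_valK. Qed.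

Lemma laplacian_sym : (laplacian_mx e R)^T = laplacian_mx e R.
Proof.
apply/matrixP => i j; rewrite !mxE sym_e; case: eqVneq => [->|] //.
Qed.

Lemma vec_fixP (x : T -> R) : vec x *m A = 0 <-> lap_fix x.
Proof.
have E v : (vec x *m A) 0 (enum_rank v) =
           ((degree e v)%:R - 1) * x v - \sum_(u | e v u) x u.
  rewrite mxE (reindex (@enum_rank T)); last first.
    by apply: onW_bij; apply: enum_rank_bij.
  have F u : vec x 0 (enum_rank u) * A (enum_rank u) (enum_rank v) =
     (if u == v then ((degree e v)%:R - 1) * x v else 0)
       - (if e v u then x u else 0).
    rewrite !mxE !enum_rankK (inj_eq enum_rank_inj) (sym_e v).
    by case: eqVneq => [->|_]; case: (e _ _);
       rewrite ?mulr1n ?mulr0n /=; ring.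
  rewrite (eq_bigr _ (fun u _ => F u)) sumrB -!big_mkcond big_pred1_eq //.
split=> [xA v|fx].
  by apply/eqP; rewrite -subr_eq0 -E xA mxE.
apply/rowP=> i; rewrite -(enum_valK i) E fx subrr mxE //.
Qed.

Lemma mult_rank : eigen_mult (laplacian_mx e R) 1 = \rank (kermx A).
Proof. by rewrite /eigen_mult mup_char_poly_sym // laplacian_sym. Qed.

Definition forcing (Z : {set T}) : Prop :=
  forall x, lap_fix x -> {in Z, forall z, x z = 0} -> forall v, x v = 0.

(** Right multiplication by [S Z] restricts a vector to the coordinates in [Z]; forcing says that
    this is injective on the kernel. *)
Let S (Z : {set T}) : 'M[R]_(#|T|, #|Z|) :=
  \matrix_(i, j) (enum_val i == enum_val j)%:R.

Let mulS Z w j : (w *m S Z) 0 j = func w (enum_val j).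
Proof.
rewrite mxE (bigD1 (enum_rank (enum_val j))) //= mxE enum_rankK eqxx mulr1.
rewrite big1 ?addr0 // => i /negPf ij; rewrite mxE.
by case: eqP => [h|]; [rewrite -h enum_valK eqxx in ij | rewrite mulr0].
Qed.

Let rank_forcing Z : forcing Z -> \rank (kermx A *m S Z) = \rank (kermx A).
Proof.
move=> fZ; rewrite -[RHS](mxrank_mul_ker _ (S Z)).
suff -> : (kermx A :&: kermx (S Z))%MS = 0 by rewrite mxrank0 addn0.
apply/eqP/rowV0P => w; rewrite sub_capmx => /andP[/sub_kermxP wA /sub_kermxP wS].
rewrite -(vecK w) in wA; move/vec_fixP/fZ: wA => w0.
apply/rowP=> i; rewrite -[i]enum_valK [RHS]mxE; apply: w0 => z zZ.
by rewrite -(enum_rankK_in zZ zZ) -mulS wS mxE.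
Qed.

Lemma mult_le_forcing Z :
  forcing Z -> (eigen_mult (laplacian_mx e R) 1%R <= #|Z|)%N.
Proof. by move=> /rank_forcing; rewrite mult_rank => <-; apply: rank_leq_col. Qed.

(** When the bound is attained, restriction to [Z] is injective between spaces of equal dimension,
    hence onto, and indicator functions lift. *)
Lemma forcing_onto Z : forcing Z -> eigen_mult (laplacian_mx e R) 1 = #|Z| ->
  {in Z, forall z, exists2 x, lap_fix x & {in Z, forall t, x t = (t == z)%:R}}.
Proof.
move=> fZ mZ z zZ.
have full : row_full (kermx A *m S Z).
  by rewrite /row_full rank_forcing // -mult_rank mZ.
have /submxP[y yE] := submx_full (delta_mx 0 (enum_rank_in zZ z) : 'rV_#|Z|) full.
exists (func (y *m kermx A)).
  by apply/vec_fixP; rewrite vecK -mulmxA mulmx_ker mulmx0.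
move=> t tZ; rewrite -{1}(enum_rankK_in zZ tZ) -mulS -mulmxA -yE mxE eqxx /=.
by rewrite (inj_in_eq (can_in_inj (enum_rankK_in zZ))).
Qed.

Lemma mult_ge_free (k : nat) (x : 'I_k -> T -> R) (a : 'I_k -> T) :
  (forall i, lap_fix (x i)) -> (forall i j, x i (a j) = (i == j)%:R) ->
  (k <= eigen_mult (laplacian_mx e R) 1%R)%N.
Proof.
move=> fx xa; rewrite mult_rank.
pose W : 'M[R]_(k, #|T|) := \matrix_i vec (x i).
have WA : (W <= kermx A)%MS.
  apply/sub_kermxP/row_matrixP => i.
  by rewrite row_mul rowK row0; apply/vec_fixP.
have W1 : W *m (\matrix_(i, j) (i == enum_rank (a j))%:R) = 1%:M.
  apply/matrixP=> i j; rewrite mxE (bigD1 (enum_rank (a j))) //= big1 ?addr0.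
    by rewrite !mxE eqxx mulr1 enum_rankK xa.
  by move=> l /negPf; rewrite !mxE => ->; rewrite mulr0.
apply: leq_trans (mxrankS WA).
by rewrite -{1}(mxrank1 R k) -W1 mxrankM_maxl.
Qed.

End LaplacianKernel.

(** * Heights and the parent map of a unicyclic graph *)

(** [N] is bounded on a finite type, so induction can run from large heights down, that is, from the
    leaves towards the cycle. *)
Lemma finite_rev_ind (T : finType) (N : T -> nat) (Pr : T -> Prop) :
  (forall v, (forall u, (N v < N u)%N -> Pr u) -> Pr v) -> forall v, Pr v.
Proof.
move=> H v; have [n] := ubnP (\max_u N u - N v)%N.
elim: n v => // n IH v vn; apply: H => u vu; apply: IH.
by have := leq_bigmax (F := N) u; lia.
Qed.

Lemma exists_height (T : finType) (f : T -> T) (K : pred T) :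
  (forall x, exists n, iter n f x \in K) ->
  exists2 N : T -> nat, {in K, forall u, N u = 0%N} &
    forall u, u \notin K -> N u = (N (f u)).+1.
Proof.
move=> reach; exists (fun x => ex_minn (reach x)) => [u uK|u uK].
  by case: ex_minnP => n _ /(_ 0%N uK); lia.
case: ex_minnP => [[|n]]; first by rewrite (negPf uK).
rewrite iterSr => fnK min_n; case: ex_minnP => m fmK min_m.
have := min_m _ fnK; have := min_n m.+1; rewrite iterSr fmK => /(_ isT); lia.
Qed.

(* The parent map: around the cycle on the cycle, towards the cycle off it.   *)
Definition parent_map (T : finType) (e : rel T) (f : T -> T) (c : seq T) :=
  [/\ forall x y, e x y = (f x == y) || (f y == x),
      forall x, f (f x) != x,
      ufcycle f c, (2 < size c)%N
    & forall x, exists n, iter n f x \in c].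

(** The witness [d] is the distance to [K]; the second vertex of a shortest path is closer. *)
Lemma exists_closer_neighbour (T : finType) (e : rel T) (K : pred T) (z : T) :
  connected_graph e -> z \in K ->
  exists d : T -> nat, forall x, x \notin K ->
    exists2 y, e x y & (d y < d x)%N.
Proof.
move=> conn zK.
have H x : exists n, [exists p : n.-tuple T, path e x p && (last x p \in K)].
  have /connectP[p ep zE] := conn x z.
  by exists (size p); apply/existsP; exists (in_tuple p); rewrite ep -zE.
exists (fun x => ex_minn (H x)) => x xK.
case: ex_minnP => [[|n]] /existsP[p] /andP[ep lK] min_n.
  by move: lK; rewrite (tuple0 p) /= (negPf xK).
case: p ep lK => [[|y p] //= ps] /andP[exy ep] lK.
exists y => //; case: ex_minnP => m _ min_m; rewrite ltnS; apply: min_m.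
by apply/existsP; exists (@Tuple n T p ps); rewrite ep.
Qed.

Lemma next_next_neq (T : eqType) (c : seq T) (x : T) :
  uniq c -> (2 < size c)%N -> x \in c -> next c (next c x) != x.
Proof.
move=> Uc c2 xc; have [i s cE] := rot_to xc.
rewrite -(next_rot i Uc x) -(next_rot i Uc) cE.
have : uniq (x :: s) by rewrite -cE rot_uniq.
have : size (x :: s) = size c by rewrite -cE size_rot.
case: s {cE} => [|y [|z s]] /=; try lia.
move=> _ /and4P[]; rewrite !inE !negb_or => /and3P[xy xz xs] /andP[yz ys] _ _.
by rewrite eqxx (eq_sym y x) (negPf xy) eqxx eq_sym.
Qed.

(** The pairs [{x, f x}] already connect the graph, so any further edge would close a second
    cycle. *)
Lemma unicyclic_parent_map (T : finType) (e : rel T) :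
  simple_graph e -> unicyclic e -> exists f c, parent_map e f c.
Proof.
move=> [sym_e irr_e] [conn [C [[c [/andP[cyc Uc] c2 CE]] uniqC]]].
have [z zc] : exists z, z \in c.
  by case: c c2 {Uc cyc CE} => // z c _; exists z; rewrite mem_head.
have [d dP] := exists_closer_neighbour conn zc.
(* The default [x] is never taken, since off [c] a closer neighbour exists. *)
pose f x := if x \in c then next c x
            else odflt x [pick y | e x y && (d y < d x)%N].
have f_off x : x \notin c -> e x (f x) && (d (f x) < d x)%N.
  move=> xc; rewrite /f (negPf xc); case: pickP => //= no.
  by have [y exy dyx] := dP x xc; have := no y; rewrite exy dyx.
have f_on x : x \in c -> f x = next c x by rewrite /f => ->.
have f_c x : x \in c -> f x \in c by move=> xc; rewrite f_on // mem_next.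
have ef x : e x (f x).
  have [xc|xc] := boolP (x \in c); first by rewrite f_on // (next_cycle cyc xc).
  by case/andP: (f_off x xc).
have fcyc : fcycle f c.
  have E : {in c &, frel f =2 frel (next c)} by move=> x y xc _ /=; rewrite f_on.
  by rewrite (eq_in_cycle E) ?cycle_next //; apply/allP.
have reach x : exists n, iter n f x \in c.
  have [n] := ubnP (d x); elim: n x => // n IH x xn.
  have [xc|xc] := boolP (x \in c); first by exists 0%N.
  have /andP[_ dfx] := f_off x xc.
  by have [|m mc] := IH (f x); [lia | exists m.+1; rewrite iterSr].
have ff x : f (f x) != x.
  have [xc|xc] := boolP (x \in c).
    by rewrite (f_on x xc) f_on ?mem_next ?next_next_neq.
  have /andP[_ d1] := f_off x xc.
  have [fc|fc] := boolP (f x \in c).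
    by apply: contraNneq xc => <-; apply: f_c.
  have /andP[_ d2] := f_off _ fc; apply/eqP=> h; rewrite h in d2; lia.
exists f, c; split=> //; last by rewrite /ucycle fcyc.
move=> x y.
pose r := [rel x y | (f x == y) || (f y == x)].
have sym_r : connect_sym r.
  by apply: sym_connect_sym => u v /=; rewrite orbC.
have to_iter n u : connect r u (iter n f u).
  elim: n => [|n IH]; first exact: connect0.
  by apply: connect_trans IH (connect1 _); rewrite /= eqxx.
have conn_r u v : connect r u v.
  have [n un] := reach u; have [m vm] := reach v.
  apply: connect_trans (to_iter n u) _.
  apply: connect_trans (_ : connect r _ (iter m f v)) _.
    apply: (connect_sub (e := frel f)); last exact: connect_cycle fcyc _ _ un vm.
    by move=> a b ab; apply: connect1; rewrite /= [f a == b]ab.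
  by rewrite sym_r to_iter.
have r_e u v : r u v -> e u v.
  by case/orP=> /eqP <-; rewrite // sym_e.
apply/idP/idP => [exy|]; last exact: r_e.
apply/negPn/negP => not_r.
have /connectP[p0 rp0 yE] := conn_r x y.
case/shortenP: rp0 yE => p rp Up _ yE.
(* The extra edge between [x] and [y] closes the simple path [x :: p] of parent edges. *)
have cyc' : ucycle e (x :: p).
  rewrite /ucycle Up andbT /= rcons_path -yE sym_e exy andbT.
  by apply: sub_path rp.
have size_p : (2 < size (x :: p))%N.
  case: p rp yE {Up cyc'} => [|a [|b p]] //=; first by move=> _ yx; rewrite yx irr_e in exy.
  by rewrite andbT => rxa yE; rewrite yE rxa in not_r.
have : [set y; x] \in cycle_edges (x :: p).
  apply/imsetP; exists y; first by rewrite yE mem_last.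
  congr [set _; _]; rewrite yE.
  case/lastP: p Up {yE rp cyc' size_p} => [|s w]; first by rewrite /= eqxx.
  rewrite last_rcons => Up; rewrite -(next_rotr 1) // -rcons_cons rotr1_rcons /=.
  by rewrite eqxx.
(* Uniqueness identifies this cycle with [C], so the extra edge is some [{t, next c t}], which is a
   parent edge after all. *)
have <- : C = cycle_edges (x :: p) by apply: uniqC; exists (x :: p).
rewrite CE => /imsetP[t tc]; rewrite -f_on // => E.
have := set22 t (f t); have := set21 t (f t); rewrite -E !inE.
have ft : f t != t by apply: contraTneq (ef t) => ->; rewrite irr_e.
move=> /orP[]/eqP tE /orP[]/eqP ftE; rewrite ftE tE ?eqxx in ft => //.
  by rewrite -tE ftE tE eqxx orbT in not_r.
by rewrite -tE ftE tE eqxx in not_r.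
Qed.

(* Eliminating along the recurrence yields a positive multiple of [y 1],      *)
(* e.g. [(a 1 * a 2 + a 4 * a 5 - 2) * y 1 = 0] when [g = 6].                 *)
Lemma short_cycle_recurrence (R : realFieldType) (g : nat) (a y : nat -> R) :
  (forall i, 1 <= a i) ->
  (forall i, a i.+1 * y i.+1 = y i.+2 + y i) ->
  y g = y 0%N -> y g.+1 = y 1%N -> y 0%N = 0 ->
  (2 < g <= 5)%N \/ g = 6%N /\ 1 < a 1%N -> y 1%N = 0.
Proof.
move=> a1 rec yg yg1 y0 gE.
have r0 := rec 0%N; have r1 := rec 1%N; have r2 := rec 2%N.
have r3 := rec 3%N; have r4 := rec 4%N; have r5 := rec 5%N.
have pos (t : R) : 0 < t -> t * y 1%N = 0 -> y 1%N = 0.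
  by move=> t0 /eqP; rewrite mulf_eq0 gt_eqF //= => /eqP.
rewrite y0 in yg r0.
have y2 : y 2%N = a 1%N * y 1%N by lra.
have y3 : y 3%N = (a 1%N * a 2%N - 1) * y 1%N by rewrite y2 in r1; lra.
have a12 : 1 <= a 1%N * a 2%N by have := a1 1%N; have := a1 2%N; nra.
have a45 : 1 <= a 4%N * a 5%N by have := a1 4%N; have := a1 5%N; nra.
have [g3|[g4|[g5|[g6 a1gt]]]] : g = 3%N \/ g = 4%N \/ g = 5%N \/ (g = 6%N /\ 1 < a 1%N).
- by case: gE => [|[-> ?]]; [lia | do 3!right].
- rewrite g3 in yg yg1; rewrite yg in r2.
  apply: (pos (1 + a 1%N)); [have := a1 1%N; lra | lra].
- rewrite g4 in yg yg1; rewrite yg in r3.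
  by apply: (pos (a 1%N * a 2%N)); lra.
- rewrite g5 in yg yg1; rewrite yg in r3 r4.
  have y4 : y 4%N = - y 1%N by lra.
  rewrite y4 in r3; apply: (pos (a 1%N * a 2%N + a 4%N - 1)); last by lra.
  by have := a1 4%N; lra.
- rewrite g6 in yg yg1; rewrite yg in r5 r4.
  have y5 : y 5%N = - y 1%N by lra.
  have y4 : y 4%N = - (a 5%N * y 1%N) by rewrite y5 in r4; lra.
  rewrite y4 y5 in r3; apply: (pos (a 1%N * a 2%N + a 4%N * a 5%N - 2)).
    by have := a1 2%N; nra.
  by lra.
Qed.

(** * The eigenvalue equation in terms of parents and children *)

Section ParentMap.

Variables (R : realFieldType) (T : finType) (e : rel T).
Variables (f : T -> T) (c : seq T).
Hypothesis pm : parent_map e f c.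

Definition nchild (v : T) : nat := #|[set u | f u == v]|.
Notation k := nchild.
Notation m := (eigen_mult (laplacian_mx e R) 1).

Let eE x y : e x y = (f x == y) || (f y == x). Proof. by case: pm. Qed.
Let ff x : f (f x) != x. Proof. by case: pm. Qed.
Let fcyc : fcycle f c. Proof. by case: pm => _ _ /andP[]. Qed.
Let Uc : uniq c. Proof. by case: pm => _ _ /andP[]. Qed.
Let c_gt2 : (2 < size c)%N. Proof. by case: pm. Qed.
Let reach x : exists n, iter n f x \in c. Proof. by case: pm. Qed.
Let sym_e : symmetric e. Proof. by move=> x y; rewrite !eE orbC. Qed.

Lemma degree_nchild v : degree e v = (k v).+1.
Proof.
rewrite /degree /nchild -add1n -(cards1 (f v)) -cardsUI.
have -> : [set f v] :&: [set u | f u == v] = set0.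
  apply/setP=> u; rewrite !inE; apply/negP => /andP[/eqP->].
  by rewrite (negPf (ff v)).
by rewrite cards0 addn0; apply: eq_card => u; rewrite !inE eE eq_sym.
Qed.

Lemma lap_fixE (x : T -> R) : lap_fix e x <->
  forall v, (k v)%:R * x v = x (f v) + \sum_(u | f u == v) x u.
Proof.
have E v : \sum_(u | e v u) x u = x (f v) + \sum_(u | f u == v) x u.
  rewrite (bigD1 (f v)) ?eE ?eqxx //=; congr (_ + _); apply: eq_bigl => u.
  rewrite eE (eq_sym (f v)); case: (eqVneq u (f v)) => [->|] /=; last by rewrite andbT.
  by rewrite (negPf (ff v)).
by split=> H v; have := H v; rewrite E degree_nchild -addn1 natrD addrK.
Qed.

Lemma pendantE v : pendant e v = (k v == 0%N).
Proof. by rewrite /pendant degree_nchild eqSS. Qed.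

Lemma nchild_parent v : (0 < k (f v))%N.
Proof. by apply/card_gt0P; exists v; rewrite inE. Qed.

Lemma nchild_gt0 v : (0 < k v)%N -> exists u, f u = v.
Proof. by case/card_gt0P=> u; rewrite inE => /eqP; exists u. Qed.

Definition pendants : {set T} := [set x | pendant e x].
Definition quasi_pendants : {set T} := [set x | quasi_pendant e x].
Definition core : {set T} := ~: (pendants :|: quasi_pendants).
Notation P := pendants.
Notation Q := quasi_pendants.
Notation V := core.

Lemma in_pendants v : (v \in P) = (k v == 0%N). Proof. by rewrite inE pendantE. Qed.

Lemma parent_notP v : f v \notin P.
Proof. by rewrite in_pendants -lt0n nchild_parent. Qed.

Lemma quasi_pendantsE : Q = f @: P.
Proof.
apply/setP=> v; rewrite inE; apply/existsP/imsetP => [[u]|[u uP ->]].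
  rewrite eE => /andP[/orP[]/eqP E uP]; last by exists u; rewrite ?inE.
  by have := parent_notP v; rewrite E inE uP.
by exists u; rewrite eE eqxx orbT; rewrite inE in uP.
Qed.

Lemma parent_pendant u : u \in P -> f u \in Q.
Proof. by rewrite quasi_pendantsE; apply: imset_f. Qed.

Lemma Q_notP v : v \in Q -> v \notin P.
Proof. by rewrite quasi_pendantsE => /imsetP[u _ ->]; apply: parent_notP. Qed.

Lemma in_core v : (v \in V) = (v \notin P) && (v \notin Q).
Proof. by rewrite in_setC in_setU negb_or. Qed.

Lemma nchildV v : v \in V -> (0 < k v)%N.
Proof. by rewrite in_core in_pendants lt0n => /andP[]. Qed.

Lemma core_or_quasi v : v \notin P -> v \notin V -> v \in Q.
Proof. by rewrite in_core => ->; rewrite negbK. Qed.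

Lemma parent_VQ v : f v \notin V -> f v \in Q.
Proof. exact/core_or_quasi/parent_notP. Qed.

Lemma childV_notP u : f u \in V -> u \notin P.
Proof. by rewrite in_core => /andP[_]; apply: contra; apply: parent_pendant. Qed.

Lemma card_PQV : #|T| = (#|P| + #|Q| + #|V|)%N.
Proof.
rewrite -(cardsC (P :|: Q)) cardsU [P :&: Q](_ : _ = set0) ?cards0 ?subn0 //.
by apply/setP=> v; rewrite in_setI in_set0; apply/negP=> /andP[vP /Q_notP]; rewrite vP.
Qed.

Hypothesis pq : #|P| = #|Q|.

Lemma parent_injP : {in P &, injective f}.
Proof. by apply/imset_injP; rewrite -quasi_pendantsE pq. Qed.

Section Fix.

Variable x : T -> R.
Hypothesis fx : lap_fix e x.

Lemma fix_eq v : (k v)%:R * x v = x (f v) + \sum_(u | f u == v) x u.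
Proof. by move/lap_fixE: fx. Qed.

(** A pendant vertex [u] off which [v = f u] hangs has no child, so its equation reads
    [0 = x (f u)]. *)
Lemma fixQ v : v \in Q -> x v = 0.
Proof.
rewrite quasi_pendantsE => /imsetP[u]; rewrite in_pendants => /eqP ku ->.
have := fix_eq u; rewrite ku mul0r big1 ?addr0 // => w /eqP wu.
by have := nchild_parent w; rewrite wu ku.
Qed.

Lemma fix_parentVQ v : (f v \in V -> x (f v) = 0) -> x (f v) = 0.
Proof. by have [fV|/parent_VQ/fixQ] := boolP (f v \in V); [apply | ]. Qed.

Lemma fix_childVQ u : f u \in V -> (u \in V -> x u = 0) -> x u = 0.
Proof.
by move=> /childV_notP uP; have [uV|/(core_or_quasi uP)/fixQ] := boolP (u \in V); [apply | ].
Qed.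

(** Given zeros on [V] and [Q], the equation at a quasi-pendant vertex involves only its pendant
    children, and [p = q] leaves exactly one of them. *)
Lemma fix_forceV : {in V, forall v, x v = 0} -> forall v, x v = 0.
Proof.
move=> xV; have xnP v : v \notin P -> x v = 0.
  by move=> vP; have [/xV//|/(core_or_quasi vP)/fixQ] := boolP (v \in V).
move=> v; have [vP|/xnP//] := boolP (v \in P).
have := fix_eq (f v); rewrite !(xnP (f _)) ?parent_notP // mulr0 add0r.
rewrite (bigD1 v) //= big1 ?addr0 // => u /andP[/eqP uv nuv].
apply: xnP; apply: contra nuv => uP; apply/eqP; exact: parent_injP.
Qed.

Lemma fix_up u : u \in V -> x u = 0 -> (forall w, w \in V -> f w = u -> x w = 0) ->
  x (f u) = 0.
Proof.
move=> uV xu xw; have := fix_eq u; rewrite xu mulr0 big1 ?addr0 // => w /eqP wu.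
by apply: fix_childVQ => [|wV]; [rewrite wu | apply: xw].
Qed.

(* Each equation expresses the value at a vertex through the values strictly  *)
(* below it; [K] cuts the recursion on the cycle.                             *)
Lemma fix_bottom_up (K : pred T) (N : T -> nat) :
  (forall u, u \notin K -> N u = (N (f u)).+1) ->
  (forall u, u \in K -> u \in Q \/ f u \in K) ->
  (forall v, v \in f @: Q :&: V -> v \notin K -> x v = 0) ->
  forall v, v \in V -> v \notin K -> x v = 0.
Proof.
move=> NK QK xZ; have childK u : u \in V -> f u \notin K -> u \notin K.
  move=> uV fuK; apply/negP => /QK[uQ|fu]; last by rewrite fu in fuK.
  by move: uV; rewrite in_core uQ andbF.
elim/(@finite_rev_ind T N) => v IH vV vK.
have [vQ|vQ] := boolP (v \in f @: Q); first by apply: xZ; rewrite // in_setI vQ.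
have [u uv] := nchild_gt0 (nchildV vV).
have uV : u \in V.
  apply: contraNT vQ => uV; rewrite -uv imset_f // core_or_quasi //.
  by apply: childV_notP; rewrite uv.
have uK : u \notin K by apply: childK => //; rewrite uv.
rewrite -uv; apply: fix_up => // [|w wV wu].
  by apply: IH => //; rewrite (NK u uK) uv.
have wK : w \notin K by apply: childK => //; rewrite wu.
by apply: IH => //; rewrite (NK w wK) wu (NK u uK) uv; lia.
Qed.

End Fix.

Lemma mult_le (Z : {set T}) : (forall x : T -> R, lap_fix e x -> {in Z, forall z, x z = 0} ->
    {in V, forall v, x v = 0}) -> (m <= #|Z|)%N.
Proof.
move=> H; apply: mult_le_forcing => // x fx xZ; apply: fix_forceV => //; exact: H.
Qed.

Lemma parent_in_cycle v : v \in c -> f v \in c.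
Proof. by move=> vc; rewrite (eqP (next_cycle fcyc vc)) mem_next. Qed.

Lemma parent_inj_cycle : {in c &, injective f}.
Proof.
move=> u v uc vc; rewrite (eqP (next_cycle fcyc uc)) (eqP (next_cycle fcyc vc)).
by move=> E; rewrite -(prev_next Uc u) E prev_next.
Qed.

Lemma cycle_pred v : v \in c -> exists2 d, d \in c & f d = v.
Proof.
move=> vc; exists (prev c v); first by rewrite mem_prev.
by rewrite (eqP (next_cycle fcyc _)) ?mem_prev // next_prev.
Qed.

Lemma iter_in_cycle n v : v \in c -> iter n f v \in c.
Proof. by move=> vc; elim: n => //= n; apply: parent_in_cycle. Qed.

Lemma iter_size_cycle v : v \in c -> iter (size c) f v = v.
Proof. by move=> vc; rewrite -(order_cycle fcyc Uc vc) (iter_order_cycle fcyc vc). Qed.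

Lemma cycle_iter u v : u \in c -> v \in c ->
  exists2 i, (i < size c)%N & v = iter i f u.
Proof.
move=> uc vc.
have uv : fconnect f u v by rewrite (fconnect_cycle fcyc uc).
exists (findex f u v); last by rewrite iter_findex.
by rewrite -(order_cycle fcyc Uc uc) findex_max.
Qed.

Lemma card_cycle : #|[set v in c]| = size c.
Proof. by rewrite cardsE; apply/card_uniqP. Qed.

(** * Upper bounds when the cycle meets [Q] *)

Section CycleThroughQ.

Variable z : T.
Hypotheses (zc : z \in c) (zQ : z \in Q).

(** Every orbit of [f] enters the cycle and so reaches [z]. As [z] is outside [V], the parity of [N]
    then properly colours [V]. *)
Lemma height_Q : exists N : T -> nat, forall u, u != z -> N u = (N (f u)).+1.
Proof.
have [|N _ NP] := @exists_height T f (pred1 z); last by exists N => u uz; apply: NP.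
move=> v; have [n nc] := reach v; have [i _ zE] := cycle_iter nc zc.
by exists (i + n)%N; rewrite iterD inE -zE.
Qed.

Lemma V_neq_z v : v \in V -> v != z.
Proof. by rewrite in_core; apply: contraTneq => ->; rewrite zQ andbF. Qed.

Lemma forcing_fQ (x : T -> R) : lap_fix e x ->
  {in f @: Q :&: V, forall v, x v = 0} -> {in V, forall v, x v = 0}.
Proof.
move=> fx xZ v vV; have [N NP] := height_Q.
apply: (fix_bottom_up fx (K := pred1 z) (N := N)) => // [u|u uZ _|].
- by rewrite inE => /eqP->; left.
- exact: xZ.
- exact: V_neq_z.
Qed.

Lemma mult_le_fQ : (m <= #|f @: Q :&: V|)%N.
Proof. exact: mult_le forcing_fQ. Qed.

Lemma two_colouring : exists col : pred T,
  forall u v, u \in V -> v \in V -> e u v -> col u = ~~ col v.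
Proof.
have [N NP] := height_Q; exists (fun v => odd (N v)) => u v uV vV.
rewrite eE => /orP[]/eqP E; rewrite -E.
  by rewrite (NP u) ?V_neq_z.
by rewrite (NP v) ?V_neq_z //= negbK.
Qed.

End CycleThroughQ.

Lemma card_colours (A : {set T}) (col : pred T) :
  #|A| = (#|[set v in A | col v == true]| + #|[set v in A | col v == false]|)%N.
Proof.
rewrite -(cardsID [set v | col v] A); congr (_ + _)%N; apply: eq_card => v.
  by rewrite !inE eqb_id.
by rewrite !inE andbC eqbF_neg.
Qed.

(* Within an independent set, the equation at [v] reduces to                  *)
(* [nchild v * x v = 0].                                                      *)
Lemma forcing_colour (col : pred T) b :
  (forall u v, u \in V -> v \in V -> e u v -> col u = ~~ col v) ->
  forcing R e [set v in V | col v == b].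
Proof.
move=> colP x fx xA; apply: fix_forceV => // v vV.
have nb u : u \in V -> e v u -> col v != b -> x u = 0.
  move=> uV evu cv; apply: xA; rewrite inE uV /=.
  by move: cv; rewrite (colP v u) //; case: (col u) b => [] [].
have [cv|cv] := boolP (col v == b); first by apply: xA; rewrite inE vV.
have := fix_eq fx v; rewrite big1 => [|u /eqP uv].
  rewrite addr0 fix_parentVQ // => [/eqP|fV].
    by rewrite mulf_eq0 pnatr_eq0 eqn0Ngt nchildV //= => /eqP.
  by apply: nb => //; rewrite eE eqxx.
apply: fix_childVQ => // [|uV]; first by rewrite uv.
by apply: nb => //; rewrite eE uv eqxx orbT.
Qed.

(** * Strict bound when the cycle lies in [V] *)

Section CycleInV.

Hypothesis cV : {subset c <= V}.

(** A child [u] in [B] will satisfy [x u = x v / nchild u]; moving these terms to the left of the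
    equation at [v] replaces the factor [nchild v] by this coefficient. *)
Definition cyc_coef (B : {set T}) (v : T) : R :=
  \sum_(u | f u == v) (1 - (u \in B)%:R / (k u)%:R).

Section CycleEquation.

Variable B : {set T}.
Hypothesis BV : {in B, forall u, u \in V /\ u \notin c}.

Let term_ge0 u : 0 <= 1 - (u \in B)%:R / (k u)%:R :> R.
Proof.
case: (boolP (u \in B)) => [/BV[uV _]|_]; last by rewrite mul0r subr0 ler01.
by rewrite subr_ge0 mul1r invf_le1 ?ltr0n ?ler1n nchildV.
Qed.

Let term1 u : u \notin B -> 1 - (u \in B)%:R / (k u)%:R = 1 :> R.
Proof. by move/negPf->; rewrite mul0r subr0. Qed.

(** All summands are nonnegative because [nchild u >= 1] on [V], and the cycle child [d], not being
    in [B], contributes a full 1. *)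
Lemma cyc_coef_ge1 d : d \in c -> 1 <= cyc_coef B (f d).
Proof.
move=> dc; rewrite /cyc_coef (bigD1 d) //= term1; last first.
  by apply/negP => /BV[_]; rewrite dc.
by rewrite lerDl sumr_ge0.
Qed.

Lemma cyc_coef_gt1 d w : d \in c -> w \notin c -> w \notin B -> f w = f d ->
  1 < cyc_coef B (f d).
Proof.
move=> dc wc wB wd; rewrite /cyc_coef (bigD1 d) //= term1; last first.
  by apply/negP => /BV[_]; rewrite dc.
rewrite ltrDl (bigD1 w) /=; last first.
  by rewrite wd eqxx; apply: contraNneq wc => ->.
by rewrite term1 // ltr_wpDr ?ltr01 // sumr_ge0.
Qed.

Lemma cyc_recurrence (x : T -> R) : lap_fix e x ->
  (forall u, u \in V -> u \notin c -> u \notin B -> x u = 0) ->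
  (forall u, u \in B -> (k u)%:R * x u = x (f u)) ->
  forall d, d \in c -> cyc_coef B (f d) * x (f d) = x (f (f d)) + x d.
Proof.
move=> fx x0 xB d dc; set v := f d.
have vV : v \in V by apply/cV/parent_in_cycle.
have dB : d \notin B by apply/negP => /BV[_]; rewrite dc.
(* Every child other than [d] contributes 0: in [B] by elimination, otherwise because [x] vanishes
   there. *)
have -> : x d = \sum_(u | f u == v) (x u - (u \in B)%:R / (k u)%:R * x v).
  rewrite (bigD1 d) //= (negPf dB) !mul0r subr0 big1 ?addr0 // => u /andP[/eqP uv ud].
  have uc : u \notin c by apply: contra ud => uc; apply/eqP; apply: parent_inj_cycle.
  have [uB|uB] := boolP (u \in B).
    have ku : (k u)%:R != 0 :> R by rewrite pnatr_eq0 -lt0n nchildV; case: (BV uB).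
    by rewrite -uv -(xB u uB) mul1r mulKf // subrr.
  rewrite !mul0r subr0; apply: fix_childVQ => // [|uV]; first by rewrite uv.
  exact: x0.
rewrite sumrB addrA -(fix_eq fx) /cyc_coef sumrB mulrBl -mulr_suml.
congr (_ * _ - _); by rewrite sumr_const /nchild cardsE.
Qed.

End CycleEquation.

Section Recurrence.

Variables (x a : T -> R).
Hypothesis rec : forall d, d \in c -> a (f d) * x (f d) = x (f (f d)) + x d.
Variable d : T.
Hypotheses (dc : d \in c) (xd : x d = 0).

Lemma cyc_force2 : x (f d) = 0 -> {in c, forall v, x v = 0}.
Proof.
move=> xfd v vc; have [i _ ->] := cycle_iter dc vc.
suff [] : x (iter i f d) = 0 /\ x (iter i.+1 f d) = 0 by [].
elim: i => // i [x1 x2]; split=> //.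
by have := rec (iter_in_cycle i dc); rewrite -!iterS x1 x2 mulr0 addr0.
Qed.

Lemma cyc_force1 : {in c, forall v, 1 <= a v} ->
  (size c <= 5)%N \/ size c = 6%N /\ 1 < a (f d) -> {in c, forall v, x v = 0}.
Proof.
move=> a1 gE; apply: cyc_force2.
apply: (@short_cycle_recurrence R (size c) (fun i => a (iter i f d))
  (fun i => x (iter i f d))) => //=.
- by move=> i; apply/a1/iter_in_cycle.
- by move=> i; apply/rec/iter_in_cycle.
- by rewrite iter_size_cycle.
- by rewrite iter_size_cycle.
- by case: gE => ?; [left; rewrite c_gt2 | right].
Qed.

End Recurrence.

Variable N : T -> nat.
Hypothesis N0 : {in c, forall u, N u = 0%N}.
Hypothesis NS : forall u, u \notin c -> N u = (N (f u)).+1.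

Definition colour_class (b : bool) : {set T} :=
  [set v in V | (v \notin c) && (odd (N v) == b)].

Lemma in_colour_class b v :
  (v \in colour_class b) = [&& v \in V, v \notin c & odd (N v) == b].
Proof. by rewrite inE. Qed.

Lemma card_colour_class : (#|colour_class true| + #|colour_class false| + size c = #|V|)%N.
Proof.
rewrite -card_cycle -(cardsID [set v in c] V) addnC; congr (_ + _)%N.
  by apply: eq_card => v; rewrite !inE andb_idl // => /cV; rewrite !inE.
rewrite -(cardsID [set v | odd (N v)] (V :\: _)); congr (_ + _)%N;
  by apply: eq_card => v; rewrite !inE; case: (odd _); case: (v \in c); rewrite ?andbT ?andbF.
Qed.

Lemma child_off_cycle u : f u \notin c -> u \notin c.
Proof. by apply: contra; apply: parent_in_cycle. Qed.

Section Colour.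

Variables (b : bool) (x : T -> R).
Hypotheses (fx : lap_fix e x) (xA : {in colour_class b, forall v, x v = 0}).

Let colour_classP v : v \in V -> v \notin c -> v \notin colour_class b -> v \in colour_class (~~ b).
Proof. by move=> vV vc; rewrite !in_colour_class vV vc /=; case: (odd _) b => [] []. Qed.

(** The children of [u] in [V] have parity [b], where [x] vanishes, so [u] depends on its parent
    alone. *)
Let xB u : u \in colour_class (~~ b) -> (k u)%:R * x u = x (f u).
Proof.
rewrite in_colour_class => /and3P[uV uc /eqP Nu].
rewrite (fix_eq fx) big1 ?addr0 // => w /eqP wu.
apply: fix_childVQ => // [|wV]; first by rewrite wu.
have wc : w \notin c by apply: child_off_cycle; rewrite wu.
by apply: xA; rewrite in_colour_class wV wc NS // wu /= Nu negbK.
Qed.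

Lemma colour_recurrence d : d \in c ->
  cyc_coef (colour_class (~~ b)) (f d) * x (f d) = x (f (f d)) + x d.
Proof.
apply: cyc_recurrence => // [u|u uV uc uB]; first by rewrite inE => /and3P[].
by apply: xA; rewrite -[b]negbK; apply: contraR uB => uA; rewrite negbK in uA; apply: colour_classP.
Qed.

Lemma colour_force : {in c, forall v, x v = 0} -> {in V, forall v, x v = 0}.
Proof.
move=> xc v vV; have [/xc//|vc] := boolP (v \in c).
have [/xA//|/(colour_classP vV vc) vB] := boolP (v \in colour_class b).
have kv : (k v)%:R != 0 :> R by rewrite pnatr_eq0 -lt0n nchildV.
apply: (mulfI kv); rewrite xB // mulr0; apply: fix_parentVQ => // fV.
have [/xc//|fc] := boolP (f v \in c); apply: xA.
move: vB; rewrite !in_colour_class fc vc (NS vc) fV vV /=.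
by case: (odd _) b => [] [].
Qed.

End Colour.

Lemma mult_le_colour_class2 b d : d \in c -> (m <= #|colour_class b| + 2)%N.
Proof.
move=> dc; apply: leq_trans (_ : _ <= #|colour_class b :|: [set d; f d]|)%N _; last first.
  by rewrite (leq_trans (leq_card_setU _ _)) // leq_add2l cards2; case: eqP.
apply: mult_le => x fx xZ.
have xA : {in colour_class b, forall v, x v = 0} by move=> v vA; apply: xZ; rewrite inE vA.
apply: (colour_force fx xA).
by apply: (cyc_force2 (colour_recurrence fx xA) dc); apply: xZ; rewrite in_setU !inE eqxx ?orbT.
Qed.

(** A vertex [w] of class [b] is outside the eliminated class [~~ b], so the coefficient at [f d],
    just after the zero at [d], exceeds 1, as [short_cycle_recurrence] requires for length 6. *)
Lemma mult_le_colour_class1 b d : d \in c ->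
  (size c <= 5)%N \/ (size c = 6%N /\
    exists w, [/\ w \in colour_class b, w \notin c & f w = f d]) ->
  (m <= #|colour_class b| + 1)%N.
Proof.
move=> dc gE; apply: leq_trans (_ : _ <= #|colour_class b :|: [set d]|)%N _; last first.
  by rewrite (leq_trans (leq_card_setU _ _)) // leq_add2l cards1.
apply: mult_le => x fx xZ.
have xA : {in colour_class b, forall v, x v = 0} by move=> v vA; apply: xZ; rewrite inE vA.
have BV : {in colour_class (~~ b), forall u, u \in V /\ u \notin c}.
  by move=> u; rewrite inE => /and3P[].
apply: (colour_force fx xA); apply: (cyc_force1 (colour_recurrence fx xA) dc).
- by apply: xZ; rewrite in_setU !inE eqxx orbT.
- by move=> v /cycle_pred[d' d'c <-]; apply: cyc_coef_ge1.
case: gE => [|[g6 [w [wA wc wd]]]]; [by left | right; split=> //].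
apply: (cyc_coef_gt1 BV dc wc) => //.
by move: wA; rewrite !in_colour_class => /and3P[_ _ /eqP->]; case: (b); rewrite !andbF.
Qed.

Section BottomUp.

Variable x : T -> R.
Hypothesis fx : lap_fix e x.
Hypothesis xZ : forall v, v \in f @: Q :&: V -> v \notin c -> x v = 0.

Lemma off_cycle0 v : v \in V -> v \notin c -> x v = 0.
Proof.
by apply: (fix_bottom_up fx NS) => // u uc; right; apply: parent_in_cycle.
Qed.

(** The equation at [w] expresses [x (f w)] through zeros at and below [w]: an attached vertex of
    [V] yields a zero on the cycle at no cost. *)
Lemma cycle_attach0 w : w \in V -> w \notin c -> x (f w) = 0.
Proof.
move=> wV wc; apply: fix_up => //; first exact: off_cycle0.
move=> u uV uw; apply: off_cycle0 => //; apply: contra wc => uc.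
by rewrite -uw parent_in_cycle.
Qed.

Lemma plain_recurrence d : d \in c ->
  cyc_coef set0 (f d) * x (f d) = x (f (f d)) + x d.
Proof.
apply: cyc_recurrence => // [u|u uV uc _|u]; rewrite ?inE //.
exact: off_cycle0.
Qed.

Lemma V_force : {in c, forall v, x v = 0} -> {in V, forall v, x v = 0}.
Proof.
by move=> xc v vV; have [/xc//|vc] := boolP (v \in c); apply: off_cycle0.
Qed.

End BottomUp.

Lemma card_fQ : (#|f @: Q :&: V| <= #|Q|)%N.
Proof. by rewrite (leq_trans (subset_leq_card (subsetIl _ _))) ?leq_imset_card. Qed.

Section Attached.

Variables d w : T.
Hypotheses (dc : d \in c) (wc : w \notin c) (wd : f w = f d).

Let wP : w \notin P.
Proof. by apply: childV_notP; rewrite wd; apply/cV/parent_in_cycle. Qed.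

Let BV0 : {in set0, forall u : T, u \in V /\ u \notin c}.
Proof. by move=> u; rewrite inE. Qed.

(** Either the equation at [w] forces this zero, or [w] lies in [Q] and puts [f d] into the forcing
    set. *)
Let attach0 (x : T -> R) : lap_fix e x ->
  {in f @: Q :&: V, forall v, x v = 0} -> x (f d) = 0.
Proof.
move=> fx xZ; rewrite -wd.
have [wV|/(core_or_quasi wP) wQ] := boolP (w \in V).
  by apply: cycle_attach0 => // v vZ _; apply: xZ.
by apply: xZ; rewrite in_setI imset_f // wd cV ?parent_in_cycle.
Qed.

Lemma mult_le_q_short : (size c <= 5)%N -> (m <= #|Q|)%N.
Proof.
move=> g5; apply: leq_trans card_fQ; apply: mult_le => x fx xZ.
have xZ' v : v \in f @: Q :&: V -> v \notin c -> x v = 0 by move=> /xZ.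
apply: (V_force fx xZ').
apply: (cyc_force1 (plain_recurrence fx xZ') (parent_in_cycle dc)).
- exact: attach0.
- by move=> v /cycle_pred[d' d'c <-]; apply: cyc_coef_ge1.
- by left.
Qed.

Lemma mult_le_q1 : (m <= #|Q| + 1)%N.
Proof.
apply: leq_trans (_ : _ <= #|f @: Q :&: V :|: [set f (f d)]|)%N _; last first.
  by rewrite (leq_trans (leq_card_setU _ _)) // cards1 leq_add2r card_fQ.
apply: mult_le => x fx xZ.
have xZ1 : {in f @: Q :&: V, forall v, x v = 0}.
  by move=> v vZ; apply: xZ; rewrite in_setU vZ.
have xZ' v : v \in f @: Q :&: V -> v \notin c -> x v = 0 by move=> /xZ1.
apply: (V_force fx xZ').
apply: (cyc_force2 (plain_recurrence fx xZ') (parent_in_cycle dc)).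
  exact: attach0.
by apply: xZ; rewrite !inE eqxx orbT.
Qed.

(** As [w] is in [Q], the set [Z] contains [f d]. Trading [f d] for its predecessor [d] does not
    enlarge [Z], and the recurrence then starts at [d] with next coefficient above 1 because of
    [w]. *)
Lemma mult_le_q6 : size c = 6%N -> w \in Q -> (m <= #|Q|)%N.
Proof.
move=> g6 wQ; set Z := f @: Q :&: V.
have fdZ : f d \in Z by rewrite in_setI -wd imset_f // wd cV ?parent_in_cycle.
apply: leq_trans (_ : _ <= #|Z :\ f d :|: [set d]|)%N _; last first.
  rewrite (leq_trans (leq_card_setU _ _)) // cards1.
  by rewrite addn1 (leq_trans _ card_fQ) // -/Z (cardsD1 (f d) Z) fdZ.
apply: mult_le => x fx xZ.
have xZ' v : v \in Z -> v \notin c -> x v = 0.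
  move=> vZ vc; apply: xZ; rewrite in_setU in_setD1 vZ andbT.
  by rewrite (contraNneq _ vc) // => ->; apply: parent_in_cycle.
apply: (V_force fx xZ'); apply: (cyc_force1 (plain_recurrence fx xZ') dc).
- by apply: xZ; rewrite !inE eqxx orbT.
- by move=> v /cycle_pred[d' d'c <-]; apply: cyc_coef_ge1.
right; split=> //; apply: (cyc_coef_gt1 BV0 dc wc) => //; by rewrite inE.
Qed.

(** Let [A], [B] be the class sizes and [g] the cycle length, so [n = 2q + A + B + g]. For [g <= 5],
    the bounds [q], [A + 1], [B + 1] give [4m <= n - g + 2]; in general [q + 1], [A + 2], [B + 2]
    give [4m <= n - g + 6], enough for [g >= 7]. For [g = 6], the attached vertex improves one of
    these bounds. *)
Lemma mult_lt_attached : (4 * m < #|T|)%N.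
Proof.
have nE := card_PQV; rewrite pq -card_colour_class in nE.
have [g5|g5] := leqP (size c) 5.
  have := mult_le_q_short g5.
  have := mult_le_colour_class1 (b := true) dc (or_introl g5).
  have := mult_le_colour_class1 (b := false) dc (or_introl g5).
  lia.
have mq := mult_le_q1; have m1 := mult_le_colour_class2 true dc.
have m2 := mult_le_colour_class2 false dc.
have [g6|g6] := eqVneq (size c) 6%N; last by lia.
have [wV|/(core_or_quasi wP) wQ] := boolP (w \in V); last first.
  by have := mult_le_q6 g6 wQ; lia.
suff : (m <= #|colour_class true| + 1)%N by lia.
apply: (mult_le_colour_class1 dc); right; split=> //; exists w; split=> //.
by rewrite in_colour_class wV wc NS // wd N0 // parent_in_cycle.
Qed.

End Attached.

End CycleInV.

Lemma mult_lt_cycleV : {subset c <= V} -> (10 <= #|T|)%N -> (4 * m < #|T|)%N.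
Proof.
move=> cV n10; have [N N0 NS] := exists_height (K := mem c) reach.
have [/existsP[w /andP[wc fwc]]|] := boolP [exists w, (w \notin c) && (f w \in c)].
  have [d dc dw] := cycle_pred fwc.
  by apply: (mult_lt_attached cV N0 NS dc wc); rewrite dw.
rewrite negb_exists => /forallP noattach.
(* With nothing attached the graph is a bare cycle, where [m <= 2] and [8 < 10 <= n]. *)
have allc v : v \in c.
  have [n] := reach v; elim: n => // n IH; rewrite iterS => fc; apply: IH.
  by have := noattach (iter n f v); rewrite fc andbT negbK.
have [v _] : exists v, v \in c by case: (c) c_gt2 => // v s _; exists v; rewrite mem_head.
have := mult_le_colour_class2 cV NS true (allc v).
have -> : colour_class N true = set0 by apply/setP=> u; rewrite !inE allc andbF.
rewrite cards0; lia.
Qed.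

End ParentMap.

(** * Eigenvectors of the extremal graph *)

Lemma modn_succ i n : (i < n)%N ->
  (i.+1 %% n = if i.+1 == n then 0 else i.+1)%N.
Proof. by move=> h; case: eqP => [->|?]; rewrite ?modnn // modn_small //; lia. Qed.

Lemma modn_pred i n : (i < n)%N ->
  ((i + n).-1 %% n = if i == 0 then n.-1 else i.-1)%N.
Proof.
move=> h; case: eqP => [->|i0]; first by rewrite add0n modn_small //; lia.
by rewrite (_ : (i + n).-1 = i.-1 + n)%N ?modnDr ?modn_small; lia.
Qed.

Section ExtremalKernel.

Variables (R : realFieldType) (k : nat).

Notation X := ('I_(3 * k) + 'I_k)%type.

Lemma sum_extremal_inl (F : X -> R) (i : 'I_(3 * k)) :
  \sum_(u | extremal_rel k (inl i) u) F u =
  F (inl (ordS i)) + F (inl (ord_pred i))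
    + \sum_(l : 'I_k | i == (3 * l)%N :> nat) F (inr l).
Proof.
rewrite big_sumType /=; congr (_ + _).
have neq : ord_pred i != ordS i.
  apply/eqP=> /(congr1 val) /=; have ik := ltn_ord i.
  by rewrite modn_succ // modn_pred //; case: eqP => ?; case: eqP => ?; lia.
rewrite (bigD1 (ordS i)) ?eqxx //= (bigD1 (ord_pred i)) /=; last first.
  by rewrite neq ord_predK eqxx orbT.
rewrite big1 ?addr0 // => j /andP[/andP[/orP[/eqP->|/eqP->]]].
  by rewrite eqxx.
by move=> _; rewrite ordSK eqxx.
Qed.

Lemma sum_extremal_inr (F : X -> R) (l : 'I_k) (h : (3 * l < 3 * k)%N) :
  \sum_(u | extremal_rel k (inr l) u) F u = F (inl (Ordinal h)).
Proof.
rewrite big_sumType /= [X in _ + X]big_pred0 // addr0.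
by rewrite (big_pred1 (Ordinal h)) // => i.
Qed.

(** Ones on [a_(j+1)] and [b_(j+1)] are balanced at the two adjacent [c]-vertices by their pendant
    vertices. The sum form gives the value -2 when [k = 1] and these two coincide. *)
Definition block_vec (j : 'I_k) (v : X) : R :=
  match v with
  | inl i => ((i %/ 3 == j) && (i %% 3 != 0))%N%:R
  | inr l => - (l == j)%:R - (l == ordS j)%:R
  end.

Lemma block_vec_fix (j : 'I_k) : lap_fix (extremal_rel k) (block_vec j).
Proof.
move=> v; have -> : (degree (extremal_rel k) v)%:R =
    \sum_(u | extremal_rel k v u) (1 : R).
  by rewrite sumr_const /degree cardsE.
case: v => [i|l]; last first.
  have h : (3 * l < 3 * k)%N by have := ltn_ord l; lia.
  rewrite !(sum_extremal_inr _ h) subrr mul0r /=.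
  by rewrite (_ : 3 * l %% 3 = 0)%N ?eqxx ?andbF //; lia.
rewrite !sum_extremal_inl /=.
have ik := ltn_ord i; have jk := ltn_ord j.
rewrite modn_pred // modn_succ //.
have [i0|i0] := eqVneq (i %% 3)%N 0%N.
  have lk : (i %/ 3 < k)%N by lia.
  have sumE (F : 'I_k -> R) :
      \sum_(l : 'I_k | i == (3 * l)%N :> nat) F l = F (Ordinal lk).
    by apply: big_pred1 => l; apply/eqP/eqP => [E|->]; [apply: val_inj|] => /=; lia.
  rewrite !sumE andbF mulr0 /= -!val_eqE /=.
  rewrite modn_succ //.
  rewrite (_ : _ && _ = (i %/ 3 == j)%N); last first.
    by case: (i.+1 =P (3 * k)%N) => ?; lia.
  rewrite (_ : _ && _ = (i %/ 3 == if j.+1 == k :> nat then 0 else j.+1)%N); last first.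
    by case: (i =P 0%N :> nat) => ?; case: (j.+1 =P k) => ?; lia.
  by ring.
rewrite !big_pred0; try by move=> l; lia.
rewrite !addr0 addrK mul1r -natrD; congr (_%:R).
by case: (i =P 0%N :> nat) => ?; case: (i.+1 =P (3 * k)%N) => ?; lia.
Qed.

End ExtremalKernel.

Lemma lap_fix_iso (R : realFieldType) (T1 T2 : finType) (e1 : rel T1)
    (e2 : rel T2) (h : T1 -> T2) (x : T2 -> R) :
  bijective h -> {mono h : u v / e1 u v >-> e2 u v} ->
  lap_fix e2 x -> lap_fix e1 (x \o h).
Proof.
move=> bij_h mono_h fx v; have := fx (h v).
have deg : degree e2 (h v) = degree e1 v.
  rewrite /degree -(card_imset _ (bij_inj bij_h)); congr #|pred_of_set _|.
  case: bij_h => g hg gh; apply/setP=> u; rewrite inE -[u]gh mono_h.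
  by rewrite mem_imset ?inE //; apply: can_inj hg.
rewrite deg (reindex h); last exact: onW_bij.
by rewrite (eq_bigl (fun u => e1 v u)) // => u; rewrite mono_h.
Qed.

Lemma mult_ge_extremal (R : realFieldType) (T : finType) (e : rel T) (k : nat) :
  simple_graph e -> graph_iso e (extremal_rel k) ->
  (k <= eigen_mult (laplacian_mx e R) 1%R)%N.
Proof.
move=> [sym_e irr_e] [h bij_h mono_h]; have [g hg gh] := bij_h.
(* Index [3 * j + 1] is [a_(j+1)], a test point where only the solution of block [j] is nonzero. *)
have lt3 (j : 'I_k) : (3 * j + 1 < 3 * k)%N by have := ltn_ord j; lia.
apply: (mult_ge_free sym_e (x := fun j => block_vec R j \o h)
  (a := fun j => g (inl (Ordinal (lt3 j))))).
  by move=> j; apply: lap_fix_iso => //; apply: block_vec_fix.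
move=> i j; rewrite /= gh /= -[i == j]val_eqE /=.
by congr ((nat_of_bool _)%:R); lia.
Qed.

(** * The equality case *)

Section Equality.

Variables (R : realFieldType) (T : finType) (e : rel T).
Variables (f : T -> T) (c : seq T).
Hypothesis pm : parent_map e f c.
Hypothesis pq : #|pendants e| = #|quasi_pendants e|.

Notation k := (nchild f).
Notation m := (eigen_mult (laplacian_mx e R) 1).
Notation P := (pendants e).
Notation Q := (quasi_pendants e).
Notation V := (core e).

Let eE x y : e x y = (f x == y) || (f y == x). Proof. by case: pm. Qed.
Let ff x : f (f x) != x. Proof. by case: pm. Qed.
Let fcyc : fcycle f c. Proof. by case: pm => _ _ /andP[]. Qed.
Let Uc : uniq c. Proof. by case: pm => _ _ /andP[]. Qed.
Let reach x : exists n, iter n f x \in c. Proof. by case: pm. Qed.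
Let sym_e : symmetric e. Proof. by move=> x y; rewrite !eE orbC. Qed.
Let f_neq x : f x != x.
Proof. by apply/eqP=> E; have := ff x; rewrite !E eqxx. Qed.

Section Matching.

Variable col : pred T.
Hypothesis colP : forall u v, u \in V -> v \in V -> e u v -> col u = ~~ col v.
Hypothesis card_col : forall b, m = #|[set v in V | col v == b]|.

Section Delta.

Variables (a : T) (x : T -> R).
Hypothesis aV : a \in V.
Hypothesis fx : lap_fix e x.
Hypothesis xa : {in [set v in V | col v == col a], forall t, x t = (t == a)%:R}.

Let fixV v : v \in V -> (k v)%:R * x v = \sum_(u | e v u && (u \in V)) x u.
Proof.
move=> vV; have := fx v; rewrite (degree_nchild pm) -addn1 natrD addrK => ->.
rewrite (bigID (mem V)) /= [X in _ + X]big1 ?addr0 // => u /andP[evu uV].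
apply: (fixQ pm fx); apply: core_or_quasi uV; apply: contraTN vV => uP.
rewrite in_core negb_and !negbK; apply/orP; right; rewrite inE.
by apply/existsP; exists u; rewrite evu; rewrite inE in uP.
Qed.

(** The neighbours of [w] in [V] have the colour of [a], so the equation at [w] sees the indicator
    of [a] only. *)
Lemma delta_other w : w \in V -> col w = ~~ col a -> x w = (e w a)%:R / (k w)%:R.
Proof.
move=> wV cw; have kw : (k w)%:R != 0 :> R.
  by rewrite pnatr_eq0 -lt0n (nchildV pm).
apply: (mulfI kw); rewrite fixV // mulrCA divff // mulr1.
rewrite (eq_bigr (fun u => (u == a)%:R)) => [|u /andP[ewu uV]]; last first.
  by apply: xa; rewrite inE uV -[col u]negbK -(colP wV uV ewu) cw negbK /=.
case: (boolP (e w a)) => ewa.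
  rewrite (bigD1 a) ?ewa //= eqxx big1 ?addr0 // => u /andP[_ /negPf->] //.
rewrite big1 // => u /andP[ewu _]; case: eqP => // ua.
by rewrite -ua ewu in ewa.
Qed.

Lemma delta_same a' : a' \in V -> col a' = col a ->
  (k a')%:R * (a' == a)%:R =
  \sum_(w | e a' w && (w \in V)) (e w a)%:R / (k w)%:R :> R.
Proof.
move=> a'V ca'; have <- : x a' = (a' == a)%:R by apply: xa; rewrite inE a'V ca' eqxx.
rewrite fixV //.
apply: eq_bigr => w /andP[ew wV]; apply: delta_other => //.
by rewrite -ca' (colP a'V wV ew) negbK.
Qed.

End Delta.

(** If [a' != a], the left side of [delta_same] is 0, while a common neighbour adds
    [1 / nchild w > 0] to a sum of nonnegative terms. *)
Lemma no_common_neighbour a a' w : a \in V -> a' \in V -> w \in V ->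
  e a w -> e a' w -> a = a'.
Proof.
move=> aV a'V wV eaw ea'w.
have aA : a \in [set v in V | col v == col a] by rewrite inE aV eqxx.
have [x fx xa] := forcing_onto sym_e
  (forcing_colour (R := R) pm pq (b := col a) colP) (card_col _) aA.
have ca : col a' = col a.
  by rewrite (colP aV wV eaw) (colP a'V wV ea'w).
have := delta_same aV fx xa a'V ca; case: eqP => // _; rewrite mulr0 => /esym/eqP.
rewrite psumr_eq0 => [/allP/(_ w)|i _]; last by rewrite divr_ge0 ?ler0n.
rewrite mem_index_enum ea'w wV sym_e eaw mul1r => /(_ isT)/=.
by rewrite invr_eq0 pnatr_eq0 eqn0Ngt (nchildV pm).
Qed.

(** With a single neighbour [w] in [V], [delta_same] at [a' = a] reads [nchild a = 1 / nchild w], so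
    both positive integers are 1. *)
Lemma V_matched a : a \in V -> k a = 1%N /\
  exists w, [/\ w \in V, e a w & forall w', w' \in V -> e a w' -> w' = w].
Proof.
move=> aV; have aA : a \in [set v in V | col v == col a] by rewrite inE aV eqxx.
have [x fx xa] := forcing_onto sym_e
  (forcing_colour (R := R) pm pq (b := col a) colP) (card_col _) aA.
have ka := nchildV pm aV.
have := delta_same aV fx xa aV erefl; rewrite eqxx mulr1 => kE.
have [/existsP[w /andP[eaw wV]]|] := boolP [exists w, e a w && (w \in V)]; last first.
  rewrite negb_exists => /forallP no; rewrite big_pred0 in kE.
    by move/eqP: kE; rewrite pnatr_eq0 eqn0Ngt ka.
  by move=> w; apply: negbTE (no w).
have wu w' : w' \in V -> e a w' -> w' = w.
  by move=> w'V eaw'; apply: no_common_neighbour w'V wV aV _ _; rewrite sym_e.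
split; last by exists w.
rewrite (big_pred1 w) in kE; last first.
  move=> u /=; apply/andP/eqP => [[? ?]|->] //; exact: wu.
have kw := nchildV pm wV.
have : (k a * k w)%:R = 1 :> R.
  by rewrite natrM kE sym_e eaw mul1r mulVf // pnatr_eq0 -lt0n.
by move/eqP; rewrite pnatr_eq1 muln_eq1 => /andP[/eqP].
Qed.

End Matching.

Section Structure.

Variable z : T.
Hypotheses (zc : z \in c) (zQ : z \in Q).
Hypothesis kV : {in V, forall a, k a = 1%N}.
Hypothesis matchV : {in V, forall a,
  exists w, [/\ w \in V, e a w & forall w', w' \in V -> e a w' -> w' = w]}.
Hypothesis fQ : {in Q, forall v, f v \in V}.
Hypothesis cardV : #|V| = (2 * #|Q|)%N.
Hypothesis noP3 : ~ has_pendant_path e 3.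

Let child_uniq v u u' : k v = 1%N -> f u = v -> f u' = v -> u = u'.
Proof.
move=> kv uv u'v; have /card_le1_eqP : (#|[set u | f u == v]| <= 1)%N.
  by rewrite -/(nchild f v) kv.
by apply; rewrite inE ?uv ?u'v.
Qed.

Lemma pendant_child v : v \in Q -> exists2 p, p \in P & f p = v.
Proof. by rewrite (quasi_pendantsE pm) => /imsetP[p pP ->]; exists p. Qed.

(** If the pendant vertex [p] were the only child of [v], then [f v], [v], [p] would form a pendant
    path attached at [f (f v)], as [f v] has [v] as its only child. *)
Lemma nchildQ_ge2 v : v \in Q -> (2 <= k v)%N.
Proof.
move=> vQ; have [p pP pv] := pendant_child vQ.
have kv : (0 < k v)%N by rewrite -pv nchild_parent.
rewrite ltn_neqAle kv andbT eq_sym; apply/eqP => kv1; apply: noP3.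
set a := f v; have ka : k a = 1%N by apply/kV/fQ.
have kp : k p = 0%N by apply/eqP; rewrite -(in_pendants pm).
have np y : f y != p.
  by apply: contraTneq pP => <-; apply: (parent_notP pm).
have av : a != v by apply: f_neq.
have vp : v != p by rewrite -pv f_neq.
have ap : a != p by apply: np.
have fav : f a != v by apply: ff.
have fpa : f p != a by rewrite pv eq_sym.
exists (fun i : 'I_3 => nth a [:: a; v; p] i), (f a); split.
- move=> i j /eqP; rewrite nth_uniq ?ltn_ord // => [/eqP/val_inj//|].
  by rewrite /= !inE negb_or av ap vp.
- by case=> [[|[|[|]]]] //= _; rewrite eq_sym ?f_neq.
- case=> [[|[|[|]]]] //= _; case=> [[|[|[|]]]] //= _; rewrite eE.
  + by rewrite (negPf (f_neq a)).
  + by rewrite -/a (eqxx a) orbT.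
  + by rewrite (negPf (np _)) (negPf fpa).
  + by rewrite -/a (eqxx a).
  + by rewrite (negPf (f_neq v)).
  + by rewrite pv eqxx orbT.
  + by rewrite (negPf (np _)) (negPf fpa).
  + by rewrite pv eqxx.
  + by rewrite (negPf (f_neq p)).
case=> [[|[|[|]]]] //= _ y yv.
- have /= ya := yv ord0; have /= yv1 := yv (@Ordinal 3 1 isT).
  rewrite eE [y == f a]eq_sym; case: (f a == y) => //=.
  by apply/negP => /eqP ya'; rewrite (child_uniq ka ya' erefl) eqxx in yv1.
- have /= ya := yv ord0; have /= yp := yv (@Ordinal 3 2 isT).
  rewrite eE -/a (negPf ya) /=.
  by apply/negP => /eqP yv1; rewrite (child_uniq kv1 yv1 pv) eqxx in yp.
have /= yv1 := yv (@Ordinal 3 1 isT).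
by rewrite eE pv (negPf yv1) (negPf (np y)).
Qed.

Lemma sum_nchild : (\sum_v k v = #|T|)%N.
Proof.
rewrite -[RHS]sum1_card [RHS](partition_big f xpredT) //=.
by apply: eq_bigr => v _; rewrite sum1dep_card.
Qed.

(** The values of [nchild] sum to [n = 4q], of which [V] takes [2q]; the [q] terms over [Q], each at
    least 2, therefore cannot exceed 2. *)
Lemma nchildQ v : v \in Q -> k v = 2%N.
Proof.
move=> vQ; apply/eqP; rewrite eqn_leq nchildQ_ge2 // andbT leqNgt; apply/negP=> kv.
have := sum_nchild; rewrite (card_PQV pm) pq cardV.
rewrite (bigID (mem V)) /= (eq_bigr (fun=> 1%N)) => [|u uV]; last exact: kV.
rewrite sum1_card cardV (bigID (mem Q)) /= (bigD1 v) /=; last first.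
  by rewrite vQ in_core vQ andbF.
have : (\sum_(i | (i \notin V) && (i \in Q) && (i != v)) 2 <=
        \sum_(i | (i \notin V) && (i \in Q) && (i != v)) k i)%N.
  by apply: leq_sum => u /andP[/andP[_ uQ] _]; apply: nchildQ_ge2.
rewrite sum_nat_const.
rewrite (_ : #|_| = #|Q|.-1)%N; last first.
  rewrite (cardsD1 v Q) vQ /=; apply: eq_card => u.
  rewrite in_setD1 andbC [LHS]unfold_in /= in_core.
  by case: (u \in Q); rewrite ?andbF ?andbT.
have : (0 < #|Q|)%N by apply/card_gt0P; exists v.
lia.
Qed.

Lemma parent_inj_notP u u' : u \notin P -> u' \notin P -> f u = f u' -> u = u'.
Proof.
move=> uP u'P E; have [fV|fV] := boolP (f u \in V).
  by apply: (child_uniq (kV fV)).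
have fuQ := parent_VQ pm fV; have [p pP pE] := pendant_child fuQ.
apply/eqP; apply/negPn/negP => uu'.
have : (#|[set u; u'; p]| <= 2)%N.
  rewrite -(nchildQ fuQ); apply: subset_leq_card; apply/subsetP => w.
  by rewrite !inE => /orP[/orP[]|] /eqP->; rewrite ?pE -?E.
rewrite setUC cardsU1 cards2 uu' !inE negb_or.
by rewrite (contraNneq _ uP) ?(contraNneq _ u'P) // => <-.
Qed.

(** By [parent_inj_notP], a non-pendant vertex whose parent is on the cycle is the cycle predecessor
    of that parent; so only pendant vertices hang off the cycle. *)
Lemma cycle_notP v : (v \in c) = (v \notin P).
Proof.
apply/idP/idP => [/(cycle_pred pm)[d _ <-]|vP]; first exact: (parent_notP pm).
have iP n : iter n f v \notin P by case: n => //= n; apply: (parent_notP pm).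
have [n] := reach v; elim: n => // n IH; rewrite iterS => fc; apply: IH.
have [d dc dE] := cycle_pred pm fc.
suff -> : iter n f v = d by [].
apply: parent_inj_notP => //; have [d' _ <-] := cycle_pred pm dc.
exact: (parent_notP pm).
Qed.

Lemma size_cycle : size c = (3 * #|Q|)%N.
Proof.
rewrite -(card_cycle pm); have := cardsC P; rewrite (card_PQV pm) pq cardV.
rewrite (_ : [set v in c] = ~: P); first by lia.
by apply/setP=> v; rewrite in_setC -cycle_notP inE.
Qed.

Lemma card_T4 : #|T| = (4 * #|Q|)%N.
Proof. by rewrite (card_PQV pm) pq cardV addnn -mul2n -mulnDl. Qed.

(** The partner of [f v] in [V] is not its only child [v], hence is [f (f v)]; this vertex is
    already matched, so its parent leaves [V]. *)
Lemma parent3_Q v : v \in Q -> f (f v) \in V /\ f (f (f v)) \in Q.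
Proof.
move=> vQ; have aV := fQ vQ; set a := f v in aV *.
have bV : f a \in V.
  have [w [wV eaw _]] := matchV aV; move: eaw; rewrite eE => /orP[/eqP->//|/eqP wa].
  by move: wV; rewrite (child_uniq (kV aV) wa erefl) in_core vQ andbF.
split=> //; apply: (parent_VQ pm); apply/negP => cV; set b := f a in bV cV.
have [w [_ _ wu]] := matchV bV.
have aw : a = w by apply: wu => //; rewrite eE eqxx orbT.
have cw : f b = w by apply: wu => //; rewrite eE eqxx.
by have := ff a; rewrite -/b cw aw eqxx.
Qed.

Lemma iter3_Q j : iter (3 * j) f z \in Q.
Proof.
elim: j => // j IH; rewrite (_ : 3 * j.+1 = (3 * j).+3)%N; last by lia.
by have [_] := parent3_Q IH.
Qed.

Definition pend (v : T) : T := odflt v [pick u in P | f u == v].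

Lemma pendP v : v \in Q -> pend v \in P /\ f (pend v) = v.
Proof.
move=> vQ; rewrite /pend; case: pickP => [u /andP[? /eqP]//|no].
by have [p pP pv] := pendant_child vQ; have := no p; rewrite pP pv eqxx.
Qed.

Definition ext_map (u : 'I_(3 * #|Q|) + 'I_#|Q|) : T :=
  match u with
  | inl i => iter i f z
  | inr j => pend (iter (3 * j) f z)
  end.

Lemma iter_inj i j : (i < 3 * #|Q|)%N -> (j < 3 * #|Q|)%N ->
  (iter i f z == iter j f z) = (i == j).
Proof.
rewrite -size_cycle -(order_cycle fcyc Uc zc) => iz jz.
apply/eqP/eqP => [E|->//].
by rewrite -(findex_iter iz) E findex_iter.
Qed.

Lemma ext_map_inj : injective ext_map.
Proof.
have lt3 (j : 'I_#|Q|) : (3 * j < 3 * #|Q|)%N by have := ltn_ord j; lia.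
have cp i (j : 'I_#|Q|) : iter i f z != pend (iter (3 * j) f z).
  have [jP _] := pendP (iter3_Q j); apply: contraTneq jP => <-.
  by rewrite -cycle_notP (iter_in_cycle pm).
move=> [i|i] [j|j] /= /eqP.
- by rewrite iter_inj // => /eqP/val_inj->.
- by rewrite (negPf (cp _ _)).
- by rewrite eq_sym (negPf (cp _ _)).
move/eqP=> E; have [_ iE] := pendP (iter3_Q i); have [_ jE] := pendP (iter3_Q j).
move/eqP: iE; rewrite E jE iter_inj ?lt3 // => /eqP ij.
by congr inr; apply: val_inj => /=; lia.
Qed.

Lemma ext_map_mono u v : e (ext_map u) (ext_map v) = extremal_rel #|Q| u v.
Proof.
have lt3 (j : 'I_#|Q|) : (3 * j < 3 * #|Q|)%N by have := ltn_ord j; lia.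
have iS (i : 'I_(3 * #|Q|)) : f (iter i f z) = iter (ordS i) f z.
  have szE := iter_size_cycle pm zc; rewrite size_cycle in szE.
  rewrite -iterS [nat_of_ord (ordS i)]modn_succ ?ltn_ord //.
  by case: eqP => [->|].
have np (j : 'I_#|Q|) y : f y != pend (iter (3 * j) f z).
  have [jP _] := pendP (iter3_Q j); apply: contraTneq jP => <-.
  exact: (parent_notP pm).
have fp (j : 'I_#|Q|) : f (pend (iter (3 * j) f z)) = iter (3 * j) f z.
  by case: (pendP (iter3_Q j)).
case: u v => [i|i] [j|j] /=; rewrite eE.
- rewrite !iS !iter_inj ?ltn_ord // -!val_eqE /=.
  by congr (_ || _); rewrite eq_sym.
- by rewrite (negPf (np _ _)) /= fp iter_inj ?lt3 // eq_sym.
- by rewrite (negPf (np _ _)) orbF fp iter_inj ?lt3 // eq_sym.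
by rewrite !(negPf (np _ _)).
Qed.

Lemma iso_extremal : graph_iso e (extremal_rel #|Q|).
Proof.
have [|g gK Kg] := inj_card_bij ext_map_inj.
  by rewrite card_T4 card_sum !card_ord; lia.
exists g; first by exists ext_map.
by move=> u v; rewrite -ext_map_mono !Kg.
Qed.

End Structure.

Lemma equality_extremal z : z \in c -> z \in Q -> ~ has_pendant_path e 3 ->
  (4 * m = #|T|)%N -> #|T| = (4 * #|Q|)%N /\ graph_iso e (extremal_rel #|Q|).
Proof.
move=> zc zQ noP3 mE.
have [col colP] := two_colouring pm zc zQ.
have mb b : (m <= #|[set v in V | col v == b]|)%N.
  by apply: mult_le_forcing => //; apply: (forcing_colour pm pq).
have cardV := card_colours V col.
have mfQ := mult_le_fQ R pm pq zc zQ.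
have fQle : (#|f @: Q| <= #|Q|)%N by apply: leq_imset_card.
have fQVle := card_fQ e f.
have nE := card_PQV pm; rewrite pq in nE.
have m1 := mb true; have m0 := mb false.
(* Here [n = 2q + #|V|], each colour class has at least [m] elements and
   [m <= #|f @: Q :&: V| <= q]; [4m = n] makes all of these tight. *)
have card_col b : m = #|[set v in V | col v == b]| by case: b; lia.
have mat a aV := @V_matched col colP card_col a aV.
have fQV : f @: Q \subset V.
  by apply/setIidPl/eqP; rewrite eqEcard subsetIl; lia.
have fQin : {in Q, forall v, f v \in V}.
  by move=> v vQ; apply: (subsetP fQV); apply: imset_f.
have kV : {in V, forall a, k a = 1%N} by move=> a /mat[].
have matchV : {in V, forall a,
  exists w, [/\ w \in V, e a w & forall w', w' \in V -> e a w' -> w' = w]}.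
  by move=> a /mat[].
have cV2 : #|V| = (2 * #|Q|)%N by lia.
split; first exact: card_T4 cV2.
exact: (iso_extremal zc zQ kV matchV fQin cV2 noP3).
Qed.

End Equality.

Theorem theorem1p3 (R : realFieldType) (T : finType) (e : rel T)
    (simple_e : simple_graph e)
    (unicyclic_e : unicyclic e)
    (card_T : (10 <= #|T|)%N)
    (pq_e : num_pendant e = num_quasi_pendant e)
    (noP3_e : ~ has_pendant_path e 3) :
  ((eigen_mult (laplacian_mx e R) 1)%:R <= #|T|%:R / 4 :> rat) /\
  ((eigen_mult (laplacian_mx e R) 1)%:R = #|T|%:R / 4 :> rat <->
   exists k : nat, #|T| = (4 * k)%N /\ graph_iso e (extremal_rel k)).
Proof.
have [f [c pm]] := unicyclic_parent_map simple_e unicyclic_e.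
set m := eigen_mult _ _.
have pq : #|pendants e| = #|quasi_pendants e| by [].
suff [le4 eq4] : (4 * m <= #|T|)%N /\ ((4 * m = #|T|)%N ->
    #|T| = (4 * #|quasi_pendants e|)%N /\ graph_iso e (extremal_rel #|quasi_pendants e|)).
  have ratE : (m%:R = #|T|%:R / 4 :> rat) <-> (4 * m = #|T|)%N.
    split=> [E|<-]; last by rewrite natrM mulrAC divff ?mul1r.
    by apply/eqP; rewrite -(eqr_nat rat) natrM E mulrC divfK.
  split; first by rewrite ler_pdivlMr ?ltr0n // -natrM mulnC ler_nat.
  rewrite ratE; split=> [/eq4 ?|[k [nE iso]]]; first by exists #|quasi_pendants e|.
  (* The extremal graph gives [k <= m], and the general bound gives [4m <= 4k]. *)
  by have := mult_ge_extremal R simple_e iso; rewrite -/m; lia.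
have [/hasP[z zc zQ]|/hasPn noQ] := boolP (has (mem (quasi_pendants e)) c).
  split; last exact: (equality_extremal pm pq zc zQ noP3_e).
  have [col colP] := two_colouring pm zc zQ.
  have mb b : (m <= #|[set v in core e | col v == b]|)%N.
    by apply: mult_le_forcing; [case: simple_e | apply: (forcing_colour pm pq)].
  have m1 := mb true; have m0 := mb false.
  have cardV := card_colours (core e) col.
  have := mult_le_fQ R pm pq zc zQ; have := card_fQ e f.
  have := card_PQV pm; rewrite pq -/m; lia.
suff : (4 * m < #|T|)%N by lia.
apply: (mult_lt_cycleV R pm pq) => // v vc.
have [d _ dv] := cycle_pred pm vc.
by rewrite in_core [_ \notin quasi_pendants e](noQ v vc) andbT -dv (parent_notP pm).
Qed.
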